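(* For all states $i,s$ of an LTS with inputs and outputs, $i \mathrel{\mathsf{iocos}} s$ holds if and only if for every formula $\phi\in\mathcal L_{\mathsf{iocos}}$, $i\models\phi$ implies $s\models\phi$.
   Context: Fix disjoint finite sets $I$ of input actions (written $a?,b?,\dots$) and $O$ of output actions (written $a!,b!,\dots$), where $O$ contains a distinguished quiescence action $\delta!$; let $L=I\cup O$. An LTS with inputs and outputs is a tuple $(S,I,O,\to)$ with $S$ a set of states and $\to\subseteq S\times L\times S$ (write $p\xrightarrow{a}p'$), such that for all $p,p'$: $p\xrightarrow{\delta!}p'$ iff $p=p'$ and $p$ has no $a!$-transition for any $a!\in O\setminus\{\delta!\}$. Throughout, LTSs are image-finite: for each $p$ and $a\in L$ there are finitely many $p'$ with $p\xrightarrow{a}p'$. Let $\mathsf{ins}(p)=\{a?\in I \mid \exists p'.\,p\xrightarrow{a?}p'\}$. A relation $R\subseteq S\times S$ is an iocos-relation if for every $(p,q)\in R$: (1) $\mathsf{ins}(q)\subseteq\mathsf{ins}(p)$; (2) for every $a?\in\mathsf{ins}(q)$ and every $p'$ with $p\xrightarrow{a?}p'$ there is $q'$ with $q\xrightarrow{a?}q'$ and $(p',q')\in R$; (3) for every $a!\in O$ and every $p'$ with $p\xrightarrow{a!}p'$ there is $q'$ with $q\xrightarrow{a!}q'$ and $(p',q')\in R$. The relation $\mathsf{iocos}$ is the union of all iocos-relations. The logic $\mathcal L_{\mathsf{iocos}}$ has formulae $\phi::=\mathrm{tt}\mid\mathrm{ff}\mid\phi\wedge\phi\mid\phi\vee\phi\mid\langle\!\langle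 a?\rangle\!\rangle\phi\mid\langle a!\rangle\phi$ with $a?\in I$, $a!\in O$; the constants and Boolean connectives have the usual meaning, $p\models\langle a!\rangle\phi$ iff there is $p'$ with $p\xrightarrow{a!}p'$ and $p'\models\phi$, and $p\models\langle\!\langle a?\rangle\!\rangle\phi$ iff either $p$ has no $a?$-transition or there is $p'$ with $p\xrightarrow{a?}p'$ and $p'\models\phi$. *)

(* Defs.v *)
From mathcomp Require Import all_boot all_classical.

Set Implicit Arguments.
Unset Strict Implicit.
Unset Printing Implicit Defensive.

Local Open Scope classical_set_scope.

(* The disjoint alphabets of inputs and outputs are two finite types, and the
   set of all labels is their disjoint sum; [delta] is the quiescence output. *)
Record ioLTS (I O : finType) (delta : O) := IoLTS {
  state :> Type;
  trans : state -> I + O -> state -> Prop;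
  quiescenceP : forall p p' : state,
    trans p (inr delta) p' <->
    p = p' /\ forall a : O, a <> delta -> ~ exists q, trans p (inr a) q;
  image_finite : forall (p : state) (a : I + O),
    finite_set [set p' | trans p a p']
}.

Section Iocos.
Variables (I O : finType) (delta : O) (T : ioLTS I delta).
Implicit Types (p q : T) (R : T -> T -> Prop).

Definition ins p : set I := [set a | exists p', trans p (inl a) p'].

Definition iocos_relation R : Prop :=
  forall p q, R p q ->
  [/\ ins q `<=` ins p,
      forall (a : I) (p' : T), ins q a -> trans p (inl a) p' ->
        exists q', trans q (inl a) q' /\ R p' q'
    & forall (a : O) (p' : T), trans p (inr a) p' ->
        exists q', trans q (inr a) q' /\ R p' q'].

Definition iocos p q : Prop := exists R, iocos_relation R /\ R p q.

End Iocos.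

Inductive formula (I O : Type) : Type :=
| Ftt
| Fff
| Fand of formula I O & formula I O
| For of formula I O & formula I O
| Fdia_in of I & formula I O
| Fdia_out of O & formula I O.

(* [Fdia_in a phi] is the input modality <<a?>>phi, which also holds at the states
   having no a?-transition; [Fdia_out a phi] is the usual diamond <a!>phi. *)
Fixpoint sat (I O : finType) (delta : O) (T : ioLTS I delta) (p : T)
    (phi : formula I O) : Prop :=
  match phi with
  | Ftt => True
  | Fff => False
  | Fand phi1 phi2 => sat p phi1 /\ sat p phi2
  | For phi1 phi2 => sat p phi1 \/ sat p phi2
  | Fdia_in a phi1 => (~ exists p', trans p (inl a) p') \/
                  (exists p', trans p (inl a) p' /\ sat p' phi1)
  | Fdia_out a phi1 => exists p', trans p (inr a) p' /\ sat p' phi1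
  end.

(* Main.v *)
(** Inclusion of satisfied formulae is itself an iocos-relation: the formula
    [<<a?>>ff] gives the inclusion of inputs, and if an [a]-successor of [p]
    satisfies, for each of the finitely many [a]-successors of [q], a formula
    refuted by it, then the modality of [a] on their conjunction separates [p] from [q]
    (for an input [a], because [q] has an [a]-transition). *)

Require Import Defs.
From mathcomp Require Import all_boot all_classical.

Local Open Scope classical_set_scope.

Section Characterization.
Variables (I O : finType) (delta : O) (T : ioLTS I delta).
Implicit Types (p q : T) (phi : formula I O).

Definition sat_le p q : Prop := forall phi, sat p phi -> sat q phi.

Lemma iocos_relation_sat (R : T -> T -> Prop) p q phi :
  iocos_relation R -> R p q -> sat p phi -> sat q phi.
Proof.
move=> HR; elim: phi p q => [||f IHf g IHg|f IHf g IHg|a f IH|a f IH] p q Rpq //=.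
- by move=> [pf pg]; split; [exact: IHf Rpq pf|exact: IHg Rpq pg].
- by move=> [pf|pg]; [left; exact: IHf Rpq pf|right; exact: IHg Rpq pg].
- have [insqp simI _] := HR _ _ Rpq.
  case=> [np|[p' [pp' p'f]]].
    by left=> qa; apply: np; exact: insqp qa.
  (* Inputs are simulated only where [q] enables them; elsewhere [q] satisfies the modality
     vacuously. *)
  have [qa|nqa] := pselect (ins q a); last by left.
  have [q' [qq' Rpq']] := simI _ _ qa pp'.
  by right; exists q'; split=> //; exact: IH Rpq' p'f.
- have [_ _ simO] := HR _ _ Rpq.
  case=> p' [pp' p'f]; have [q' [qq' Rpq']] := simO _ _ pp'.
  by exists q'; split=> //; exact: IH Rpq' p'f.
Qed.

Lemma finite_separation p (A : set T) : finite_set A ->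
  (forall q, A q -> ~ sat_le p q) ->
  exists phi, sat p phi /\ forall q, A q -> ~ sat q phi.
Proof.
(* [{classic T}] gives the states the decidable equality needed to list [A] as a sequence. *)
move=> /(@finite_seqP {classic T}) [s ->].
elim: s => [|q s IH] sep; first by exists (Ftt I O).
have [|f [pf sf]] := IH.
  by move=> r rs; apply: sep; rewrite /= in_cons; apply/orP; right.
have /existsNP[g /not_implyP[pg nqg]] : ~ sat_le p q.
  by apply: sep; rewrite /= in_cons eqxx.
exists (Fand g f); split=> // r; rewrite /= in_cons => /orP[/eqP->|rs] [rg rf] //.
exact: sf rs rf.
Qed.

(** Phrased with a plain diamond for any label, so that it serves both simulation clauses; image
    finiteness enters here. *)
Lemma sat_le_successor p q p' (a : I + O) : trans p a p' ->
  (forall phi, (exists p', trans p a p' /\ sat p' phi) ->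
               exists q', trans q a q' /\ sat q' phi) ->
  exists q', trans q a q' /\ sat_le p' q'.
Proof.
move=> pp' dia; apply: contrapT => noq'.
have [|f [p'f nf]] := @finite_separation p' _ (image_finite q a).
  by move=> q' qq' le; apply: noq'; exists q'.
have [|q' [qq' q'f]] := dia f; first by exists p'.
exact: nf qq' q'f.
Qed.

Lemma sat_le_iocos_relation : iocos_relation sat_le.
Proof.
move=> p q le; split=> [a qa|a p' qa pp'|a p' pp'].
- apply: contrapT => npa.
  by have [|nqa|[? []]] := le (Fdia_in a (Fff I O)); first by left.
- apply: sat_le_successor pp' _ => f pf.
  (* Since [qa] rules out the vacuous disjunct at [q], the input modality yields a plain diamond. *)
  by have [|nqa|//] := le (Fdia_in a f); first by right.
- by apply: sat_le_successor pp' _ => f; exact: (le (Fdia_out a f)).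
Qed.

End Characterization.

Theorem theorem1 (I O : finType) (delta : O) (T : ioLTS I delta) (i s : T) :
  iocos i s <-> forall phi : formula I O, sat i phi -> sat s phi.
Proof.
split=> [[R [HR Ris]] phi|le]; first exact: (iocos_relation_sat _ _ _ _ R).
by exists (@sat_le _ _ _ T); split=> //; exact: sat_le_iocos_relation.
Qed.
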